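(* For all positive integers $n$ and $m$, there exists an orbit equivalence coupling from $\mathbb Z^m$ to $\mathbb Z^n$ which is, for every $\varepsilon>0$, $(\varphi_\varepsilon,\psi_\varepsilon)$-integrable, where $$\varphi_\varepsilon(x)=\frac{x^{n/m}}{\log(x)^{1+\varepsilon}}\quad\text{and}\quad\psi_\varepsilon(x)=\frac{x^{m/n}}{\log(x)^{1+\varepsilon}}.$$ In particular, if $n<m$, then there is an orbit equivalence coupling from $\mathbb Z^m$ to $\mathbb Z^n$ which is $(\mathrm L^p,\mathrm L^{p'})$-integrable for all $p<\frac nm$ and $p'<\frac mn$.
   Context: An orbit equivalence coupling from $\Gamma=\langle S_\Gamma\rangle$ to $\Lambda=\langle S_\Lambda\rangle$ ($S_\Gamma,S_\Lambda$ finite symmetric) is a standard probability space $(X,\mu)$ with free (up to null sets) measure-preserving actions of $\Gamma$ and $\Lambda$ such that $\Gamma\cdot x=\Lambda\cdot x$ for almost every $x\in X$. For $y\in\Lambda\cdot x$, $d_{S_\Lambda}(x,y)$ is the minimal word length of $\lambda\in\Lambda$ with $y=\lambda\cdot x$; $d_{S_\Gamma}$ is defined similarly. For non-decreasing $\varphi,\psi\colon[0,\infty)\to[0,\infty)$, the coupling is $(\varphi,\psi)$-integrable if for all $\gamma\in\Gamma$ and $\lambda\in\Lambda$ there are $c_\gamma,c_\lambda>0$ such that $$\int_X\varphi\left(\frac{d_{S_\Lambda}(x,\gamma\cdot x)}{c_\gamma}\right)d\mu(x)<\infty\quad\text{and}\quad\int_X\psi\left(\frac{d_{S_\Gamma}(x,\lambda\cdot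 x)}{c_\lambda}\right)d\mu(x)<\infty.$$ $\mathrm L^p$ stands for $\varphi(t)=t^p$. Integrability depends only on the behaviour of $\varphi,\psi$ at infinity; the formulas for $\varphi_\varepsilon,\psi_\varepsilon$ are meant for large $x$, and $\varphi_\varepsilon,\psi_\varepsilon$ denote any non-decreasing functions $[0,\infty)\to[0,\infty)$ coinciding with them for large $x$. *)

(* Defs.v *)
From mathcomp Require Export all_boot all_order all_algebra.
From mathcomp Require Export all_classical all_reals all_analysis.

Set Implicit Arguments.
Unset Strict Implicit.
Unset Printing Implicit Defensive.

Import Order.TTheory GRing.Theory Num.Theory.
Import numFieldNormedType.Exports.

Local Open Scope classical_set_scope.
Local Open Scope ring_scope.

(* All acting groups are abelian here, hence are zmodTypes written additively;
   ℤ^m is the additive group of 'rV[int]_m. *)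

(* A standard Borel space: the σ-algebra is, up to a bijection, the Borel
   σ-algebra of a Polish space. In MathComp-Analysis a pseudometric type is a
   metric space (up to the choice of a compatible metric) exactly when it is
   Hausdorff, and then second countability amounts to separability. *)
Definition standard_Borel (R : realType) (d : measure_display)
    (T : measurableType d) : Prop :=
  exists (Y : completePseudoMetricType R) (f : T -> Y),
    [/\ hausdorff_space Y, @second_countable Y, bijective f &
        forall A : set T, measurable A <-> <<s @open Y >> (f @` A)].

(* The group is at most countable in all uses, so that measurability of the
   action is measurability of each of its transformations. *)
Definition pmp_action (R : realType) (d : measure_display)
    (T : measurableType d) (P : probability T R) (G : zmodType)
    (a : G -> T -> T) : Prop :=
  [/\ forall x, a 0 x = x,
      forall g h x, a (g + h) x = a g (a h x),
      forall g, measurable_fun [set: T] (a g) &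
      forall g A, measurable A -> P (a g @^-1` A) = P A].

Definition essentially_free (R : realType) (d : measure_display)
    (T : measurableType d) (P : probability T R) (G : zmodType)
    (a : G -> T -> T) : Prop :=
  {ae P, forall x, forall g, a g x = x -> g = 0}.

Definition orbit_of (T : Type) (G : zmodType) (a : G -> T -> T) (x : T) :
  set T := range (fun g => a g x).

Structure oe_coupling (R : realType) (G H : zmodType) := OECoupling {
  oe_display : measure_display ;
  oe_space : measurableType oe_display ;
  oe_prob : probability oe_space R ;
  oe_actl : G -> oe_space -> oe_space ;
  oe_actr : H -> oe_space -> oe_space ;
  oe_standard : standard_Borel R oe_space ;
  oe_pmpl : pmp_action oe_prob oe_actl ;
  oe_pmpr : pmp_action oe_prob oe_actr ;
  oe_freel : essentially_free oe_prob oe_actl ;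
  oe_freer : essentially_free oe_prob oe_actr ;
  oe_orbits : {ae oe_prob, forall x, orbit_of oe_actl x = orbit_of oe_actr x}
}.

Definition words (G : zmodType) (S : set G) : set (seq G) :=
  [set w | forall s, s \in w -> S s].

Definition symmetric_generating (G : zmodType) (S : set G) : Prop :=
  [/\ finite_set S,
      forall s, S s -> S (- s) &
      forall g, exists2 w, words S w & \sum_(s <- w) s = g].

(* The minimum of a set of natural numbers, with value 0 on the empty set. *)
Definition min_nat (A : set nat) : nat :=
  xget 0%N [set k | A k /\ forall j, A j -> (k <= j)%N].

Definition word_length (G : zmodType) (S : set G) (g : G) : nat :=
  min_nat [set size w | w in words S `&` [set w | \sum_(s <- w) s = g]].

(* Only meaningful when y is in the orbit of x (it is 0 otherwise); in a
   coupling this fails only on a null set. *)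
Definition orbit_dist (T : Type) (G : zmodType) (S : set G)
    (a : G -> T -> T) (x y : T) : nat :=
  min_nat [set word_length S g | g in [set g | a g x = y]].

(* A non-decreasing function [0,∞) → [0,∞); the values of [phi] at negative
   reals are irrelevant. *)
Definition integrability_rate (R : realType) (phi : R -> R) : Prop :=
  (forall x, 0 <= x -> 0 <= phi x) /\
  (forall x y, 0 <= x -> x <= y -> phi x <= phi y).

Definition oe_integrable (R : realType) (G H : zmodType)
    (SG : set G) (SH : set H) (phi psi : R -> R)
    (C : oe_coupling R G H) : Prop :=
  (forall g : G, exists2 c : R, 0 < c &
    (\int[oe_prob C]_x
       (phi ((orbit_dist SH (@oe_actr _ _ _ C) x (oe_actl g x))%:R / c))%:E
     < +oo)%E) /\
  (forall h : H, exists2 c : R, 0 < c &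
    (\int[oe_prob C]_x
       (psi ((orbit_dist SG (@oe_actl _ _ _ C) x (oe_actr h x))%:R / c))%:E
     < +oo)%E).

(* x^q / log(x)^(1+ε) *)
Definition power_over_log (R : realType) (q eps : R) (x : R) : R :=
  x `^ q / (ln x) `^ (1 + eps).

(* Main.v *)
(** Read a binary sequence as an element of (Z_2)^m, bit i being the digit of
    position [i %/ m] of the coordinate [i %% m]; then Z^m acts by translation,
    as a product of m odometers, and preserves the fair coin-tossing measure.
    Up to a null set the orbits are the classes of tail equality, so the actions
    of Z^m and Z^n obtained in this way on the same space of binary sequences
    have the same orbits.

    Translation by g in Z^m changes a bit of index at least m * K only if a carry
    occurs beyond the first K digits of some coordinate, which has probability
    O(2^-K). Otherwise the change is the translation by a vector of Z^n with
    entries O(2^(m K / n)). Hence the integral of [phi] of the distance is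
    bounded by a multiple of the sum of the phi (2^(m K / n)) 2^-K, which for
    phi x = x^(n/m) / log(x)^(1 + eps) is a multiple of the sum of the
    K^-(1 + eps), and for phi x = x^p with p < n / m is a geometric series. *)

From HB Require Import structures.
Require Import Defs.
From mathcomp Require Import measurable_realfun zify lra.
Set Implicit Arguments.
Unset Strict Implicit.
Unset Printing Implicit Defensive.
Import Order.TTheory GRing.Theory Num.Theory.
Import numFieldNormedType.Exports.
Local Open Scope classical_set_scope.
Local Open Scope ring_scope.

(** * Odometers on binary sequences *)

(** The residue modulo [2 ^ K] of the 2-adic integer in coordinate [j], least significant digit
    first. The dimension is [r.+1], hence positive. *)
Definition coord_val (r j K : nat) (x : nat -> bool) : nat :=
  (\sum_(k < K) x (k * r.+1 + j) * 2 ^ k)%N.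

(** Each digit is the top binary digit of the translated residue modulo [2 ^ k.+1], so that carries
    stay implicit in the reduction. *)
Definition odometer (r : nat) (g : 'rV[int]_r.+1) (x : nat -> bool) :
    nat -> bool :=
  fun i => let j := (i %% r.+1)%N in let k := (i %/ r.+1)%N in
  (2 ^ k)%N%:Z <=
    (((coord_val r j k.+1 x)%:Z + g 0%R (inord j)) %% (2 ^ k.+1)%N%:Z)%Z.

Lemma coord_val0 r j x : coord_val r j 0 x = 0%N.
Proof. by rewrite /coord_val big_ord0. Qed.

Lemma coord_valS r j K x :
  coord_val r j K.+1 x = (coord_val r j K x + x (K * r.+1 + j) * 2 ^ K)%N.
Proof. by rewrite /coord_val big_ord_recr. Qed.

Lemma coord_val_lt r j K x : (coord_val r j K x < 2 ^ K)%N.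
Proof.
elim: K => [|K IH]; first by rewrite coord_val0.
by rewrite coord_valS expnS; case: (x _); lia.
Qed.

Lemma coord_val_mod r j K L x : (K <= L)%N ->
  coord_val r j K x = (coord_val r j L x %% 2 ^ K)%N.
Proof.
move=> KL; rewrite -(subnKC KL); elim: (L - K)%N => [|n IH].
  by rewrite addn0 modn_small // coord_val_lt.
by rewrite addnS coord_valS expnD mulnA mulnAC addnC modnMDl -IH.
Qed.

Lemma modz_double (a : int) K :
  (a %% (2 ^ K.+1)%N%:Z)%Z = (a %% (2 ^ K)%N%:Z)%Z +
    ((2 ^ K)%N%:Z <= (a %% (2 ^ K.+1)%N%:Z)%Z)%R%:Z * (2 ^ K)%N%:Z.
Proof.
have p0 : (2 ^ K)%N%:Z != 0 by rewrite eqz_nat expn_eq0.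
have p1 : (2 ^ K.+1)%N%:Z != 0 by rewrite eqz_nat expn_eq0.
have e : (2 ^ K.+1)%N%:Z = 2 * (2 ^ K)%N%:Z by rewrite expnS PoszM.
have h1 := modz_ge0 a p1; have := ltz_mod a p1 => h2.
set b := (a %% (2 ^ K.+1)%N%:Z)%Z in h1 h2 *.
have -> : (a %% (2 ^ K)%N%:Z)%Z = (b %% (2 ^ K)%N%:Z)%Z.
  by rewrite {1}(divz_eq a (2 ^ K.+1)%N%:Z) -/b e mulrA modzMDl.
have pp : 0 < (2 ^ K)%N%:Z :> int by rewrite ltz_nat expn_gt0.
case: (boolP (_ <= b)) => hb.
- have -> : b = 1 * (2 ^ K)%N%:Z + (b - (2 ^ K)%N%:Z) by lia.
  rewrite modzMDl modz_small /=; first by lia.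
  by apply/andP; split; lia.
- by rewrite modz_small ?mul0r ?addr0 //; apply/andP; split; lia.
Qed.

Lemma modn_coord r k j : (j < r.+1)%N -> ((k * r.+1 + j) %% r.+1 = j)%N.
Proof. by move=> jr; rewrite modnMDl modn_small. Qed.

Lemma divn_coord r k j : (j < r.+1)%N -> ((k * r.+1 + j) %/ r.+1 = k)%N.
Proof. by move=> jr; rewrite divnMDl // divn_small // addn0. Qed.

(** Induction on [K]: by [modz_double], the digit defined by [odometer] is what takes the residue
    modulo [2 ^ K] to the one modulo [2 ^ K.+1]. *)
Lemma coord_val_odometer r (g : 'rV[int]_r.+1) x j K : (j < r.+1)%N ->
  (coord_val r j K (odometer g x))%:Z =
  (((coord_val r j K x)%:Z + g 0%R (inord j)) %% (2 ^ K)%N%:Z)%Z.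
Proof.
move=> jr; elim: K => [|K IH]; first by rewrite !coord_val0 modz1.
rewrite coord_valS PoszD IH modz_double PoszM /odometer modn_coord // divn_coord //.
congr (_ + _); rewrite coord_valS PoszD PoszM.
(* Digit [K] of [x] contributes a multiple of the modulus [2 ^ K]. *)
by rewrite [_ + _%:Z * _]addrC -[_ * _ + _ + _]addrA modzMDl.
Qed.

Lemma coord_val_prefix r K x y :
  (forall i, (i < r.+1 * K)%N -> x i = y i) <->
  (forall j, (j < r.+1)%N -> coord_val r j K x = coord_val r j K y).
Proof.
split=> [h j jr|h i iK].
  by apply: eq_bigr => k _; rewrite h //; have := ltn_ord k; nia.
have jr : (i %% r.+1 < r.+1)%N by rewrite ltn_mod.
have kK : (i %/ r.+1 < K)%N by rewrite ltn_divLR // mulnC.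
have := h _ jr => {}h.
(* Equality at level [K] descends to lower levels by reduction; two consecutive levels then
   determine the digit. *)
have : forall L, (L <= K)%N ->
    coord_val r (i %% r.+1) L x = coord_val r (i %% r.+1) L y.
  by move=> L LK; rewrite !(coord_val_mod _ _ _ LK) h.
move=> {}h; have := h _ kK; rewrite !coord_valS (h _ (ltnW kK)).
rewrite -divn_eq => /addnI /eqP; rewrite eqn_pmul2r ?expn_gt0 //.
by case: (x i); case: (y i).
Qed.

Lemma coord_val_inj r x y :
  (forall j K, (j < r.+1)%N -> coord_val r j K x = coord_val r j K y) -> x =1 y.
Proof.
move=> h i; suff: forall l, (l < r.+1 * i.+1)%N -> x l = y l.
  by apply; nia.
by apply/coord_val_prefix => j jr; exact: h.
Qed.

Lemma odometer0 r x : @odometer r 0 x =1 x.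
Proof.
apply: (@coord_val_inj r) => j K jr; apply/eqP; rewrite -eqz_nat.
rewrite coord_val_odometer // mxE addr0 modz_small //.
by rewrite lez_nat ltz_nat coord_val_lt.
Qed.

Lemma odometerD r (g h : 'rV[int]_r.+1) x :
  odometer (g + h) x =1 odometer g (odometer h x).
Proof.
apply: (@coord_val_inj r) => j K jr; apply/eqP; rewrite -eqz_nat.
by rewrite !coord_val_odometer // modzDml mxE [g _ _ + _]addrC addrA.
Qed.

Lemma eqz_mod_pow2 (a b : int) :
  (forall K, (a = b %[mod (2 ^ K)%N%:Z])%Z) -> a = b.
Proof.
move=> h; apply/eqP; rewrite -subr_eq0; apply/negPn/negP => ab.
(* The modulus [2 ^ |a - b|] exceeds [|a - b|]. *)
have /eqP := h `|a - b|%N; rewrite eqz_mod_dvd dvdzE /=.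
move=> /dvdn_leq; rewrite absz_gt0 => /(_ ab).
by rewrite leqNgt ltn_expl.
Qed.

(** A fixed point forces every entry of [g] to vanish modulo all powers of 2. *)
Lemma odometer_free r (g : 'rV[int]_r.+1) x : odometer g x =1 x -> g = 0.
Proof.
move=> gx; apply/rowP => j; rewrite mxE; apply: eqz_mod_pow2 => K.
have /eqP := coord_val_odometer g x K (ltn_ord j).
rewrite inord_val {1}/coord_val; under eq_bigr do rewrite gx.
rewrite -/(coord_val _ _ _ _).
rewrite -{1}[(coord_val r j K x)%:Z](modz_small (d := (2 ^ K)%N%:Z)); last first.
  by rewrite lez_nat ltz_nat coord_val_lt.
by rewrite -{1}[(coord_val r j K x)%:Z]addr0 eqz_modDl => /eqP ->.
Qed.

(* Past the level K where the finite tails become equal, the two truncated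
   values differ by a constant, which is the translation vector. *)
Lemma odometer_of_tail_eq r (x y : nat -> bool) N K : (N <= r.+1 * K)%N ->
  (forall i, (N <= i)%N -> x i = y i) ->
  exists2 h : 'rV[int]_r.+1, odometer h x =1 y & forall j, (`|h 0%R j| <= 2 ^ K)%N.
Proof.
move=> NK xy.
pose h : 'rV[int]_r.+1 :=
  \row_j ((coord_val r j K y)%:Z - (coord_val r j K x)%:Z).
exists h; last first.
  move=> j; rewrite mxE; have := coord_val_lt r j K x.
  by have := coord_val_lt r j K y; lia.
have E j L : (j < r.+1)%N -> (K <= L)%N ->
    (coord_val r j L y)%:Z = (coord_val r j L x)%:Z + h 0 (inord j).
  move=> jr KL; rewrite -(subnKC KL); elim: (L - K)%N => [|n IH].
    by rewrite addn0 mxE inordK //; lia.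
  rewrite addnS !coord_valS !PoszD IH xy; last by nia.
  by lia.
apply: (@coord_val_inj r) => j L jr; apply/eqP; rewrite -eqz_nat.
rewrite coord_val_odometer //.
have lt M z : (coord_val r j M z)%:Z = ((coord_val r j M z)%:Z %% (2 ^ M)%N%:Z)%Z.
  by rewrite modz_small // lez_nat ltz_nat coord_val_lt.
have [KL|/ltnW LK] := leqP K L; first by rewrite -E // -lt.
rewrite (coord_val_mod r j x LK) (coord_val_mod r j y LK) -!modz_nat modzDml -E //.
Qed.

(** From level [K] on no reduction takes place, so the truncated values of [x] and of its translate
    differ by the constant [g]; comparing consecutive levels gives equal digits. *)
Lemma odometer_no_carry r (g : 'rV[int]_r.+1) x K :
  (forall j : 'I_r.+1, 0 <= (coord_val r j K x)%:Z + g 0 j < (2 ^ K)%N%:Z) ->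
  forall i, (r.+1 * K <= i)%N -> odometer g x i = x i.
Proof.
move=> h i Ki.
have jr : (i %% r.+1 < r.+1)%N by rewrite ltn_mod.
have := h (Ordinal jr) => /= {}h.
set j := (i %% r.+1)%N in jr h *.
have gj : inord j = Ordinal jr by apply: val_inj; rewrite /= inordK.
have E L : (K <= L)%N -> (coord_val r j L (odometer g x))%:Z =
    (coord_val r j L x)%:Z + g 0 (Ordinal jr).
  move=> KL; rewrite coord_val_odometer // gj modz_small //.
  rewrite -(subnKC KL); elim: (L - K)%N => [|n IH]; first by rewrite addn0.
  rewrite addnS coord_valS PoszD expnS.
  by case: (x _); rewrite /= ?mul1n ?mul0n; lia.
have iE : (i = i %/ r.+1 * r.+1 + j)%N by exact: divn_eq.
have Kk : (K <= i %/ r.+1)%N by rewrite leq_divRL // mulnC.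
have := E _ (leqW Kk); rewrite !coord_valS !PoszD (E _ Kk) -iE => H.
have : (odometer g x i * 2 ^ (i %/ r.+1) = x i * 2 ^ (i %/ r.+1))%N by lia.
move/eqP; rewrite eqn_pmul2r ?expn_gt0 //.
by case: (odometer g x i); case: (x i).
Qed.

(** * The Cantor space as a complete metric space *)

Definition cylinder (N : nat) (x : nat -> bool) : set (nat -> bool) :=
  [set y | forall i, (i < N)%N -> y i = x i].

Lemma sub_cylinder N M x : (N <= M)%N -> cylinder M x `<=` cylinder N x.
Proof. by move=> NM y h i iN; apply: h; exact: leq_trans NM. Qed.

Lemma cylinder_sym N x y : cylinder N x y -> cylinder N y = cylinder N x.
Proof. by move=> h; apply/seteqP; split=> z hz i iN; rewrite hz // h. Qed.

(** The parameter [R] provides the radii of the balls in the pseudometric structure. *)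
Definition bitstream (R : realType) : Type := nat -> bool.

HB.instance Definition _ (R : realType) :=
  Pointed.copy (bitstream R) (nat -> bool).

HB.instance Definition _ (R : realType) :=
  hasNbhs.Build (bitstream R)
    (fun x A => exists N, cylinder N x `<=` A).

(* The condition 0 < e makes the triangle inequality hold for all radii. *)
Definition bitstream_ball (R : realType) (x : bitstream R) (e : R)
    (y : bitstream R) : Prop :=
  0 < e /\ forall k : nat, e <= k.+1%:R^-1 -> x k = y k.

Lemma bitstream_ball_center (R : realType) (x : bitstream R) (e : R) :
  0 < e -> bitstream_ball x e x.
Proof. by split. Qed.

Lemma bitstream_ball_sym (R : realType) (x y : bitstream R) (e : R) :
  bitstream_ball x e y -> bitstream_ball y e x.
Proof. by case=> e0 h; split=> // k /h. Qed.

Lemma bitstream_ball_triangle (R : realType) (x y z : bitstream R) (e1 e2 : R) :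
  bitstream_ball x e1 y -> bitstream_ball y e2 z -> bitstream_ball x (e1 + e2) z.
Proof.
case=> e1_gt0 h1 [e2_gt0 h2]; split=> [|k ke]; first exact: addr_gt0.
by rewrite h1 ?h2 //; apply: le_trans ke; rewrite ?lerDl ?lerDr ltW.
Qed.

Lemma cylinder_ball (R : realType) (N : nat) (x : bitstream R) :
  bitstream_ball x N.+1%:R^-1 `<=` cylinder N x.
Proof.
move=> y [_ h] i iN; rewrite h // lef_pV2 ?posrE ?ltr0n // ler_nat.
exact: ltnW.
Qed.

(** With [cylinder_ball], this makes balls and cylinders define the same neighbourhoods; [N] depends
    on the radius only. *)
Lemma ball_cylinder (R : realType) (e : R) : 0 < e ->
  exists N, forall x : bitstream R, cylinder N x `<=` bitstream_ball x e.
Proof.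
move=> e0; exists (Num.truncn e^-1).+1 => x y h; split=> // k ke; rewrite h //.
rewrite ltnS; apply: ltnW; rewrite truncn_gt_nat -[_%:R]invrK lef_pV2 //.
by rewrite posrE invr_gt0.
Qed.

Lemma bitstream_nbhsE (R : realType) :
  @nbhs _ (bitstream R) = nbhs_ (entourage_ (@bitstream_ball R)).
Proof.
apply/funext => x; apply/seteqP; split=> A.
- case=> N NA; exists [set xy | bitstream_ball xy.1 N.+1%:R^-1 xy.2].
    by exists N.+1%:R^-1 => //=; rewrite invr_gt0.
  by move=> y /xsectionP /cylinder_ball /NA.
- move=> [E [e /= e0 eE] EA]; have [N h] := ball_cylinder e0; exists N => y Ny.
  by apply/EA/xsectionP/eE/h.
Qed.

HB.instance Definition _ (R : realType) :=
  Nbhs_isPseudoMetric.Build R (bitstream R) (@bitstream_nbhsE R)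
    (@bitstream_ball_center R) (@bitstream_ball_sym R)
    (@bitstream_ball_triangle R) erefl.

Lemma bitstream_nbhsP (R : realType) (x : bitstream R) (A : set (bitstream R)) :
  nbhs x A <-> exists N, cylinder N x `<=` A.
Proof. by []. Qed.

Lemma bitstream_complete (R : realType) (F : set_system (bitstream R)) :
  ProperFilter F -> cauchy F -> cvg F.
Proof.
move=> PF /cauchyP cF.
have /choice[c cE] : forall N, exists x : bitstream R, F (cylinder N x).
  move=> N; have [|x Fx] := cF N.+1%:R^-1; first by rewrite invr_gt0.
  by exists x; apply: filterS Fx; exact: cylinder_ball.
(* Every member of the cylinder of length [i.+1] around [c i.+1] has the same bit [i], which is the
   bit of the limit. *)
pose y : bitstream R := fun i => c i.+1 i.
apply/cvg_ex; exists y => A [N NA]; apply: (filterS NA).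
have : forall M, (M <= N)%N -> F (cylinder M y).
  elim=> [|M IH MN]; first by move=> _; apply: filterS filterT => z _ i.
  apply: (filterS _ (filterI (cE M.+1) (IH (ltnW MN)))) => z [h1 h2] i.
  by rewrite ltnS leq_eqVlt => /predU1P[->|/h2//]; exact: h1.
exact.
Qed.

HB.instance Definition _ (R : realType) :=
  Uniform_isComplete.Build (bitstream R) (@bitstream_complete R).

Lemma bitstream_hausdorff (R : realType) : hausdorff_space (bitstream R).
Proof.
move=> x y xy; apply/funext => i.
have [| |z [h1 h2]] := xy (cylinder i.+1 x) (cylinder i.+1 y).
- by exists i.+1.
- by exists i.+1.
- by rewrite -h1 // -h2.
Qed.

Lemma bitstream_openP (R : realType) (A : set (bitstream R)) :
  open A <-> forall x, A x -> exists N, cylinder N x `<=` A.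
Proof. by rewrite openE; split=> h x /h /bitstream_nbhsP. Qed.

Lemma open_cylinder (R : realType) N x : open (cylinder N x : set (bitstream R)).
Proof. by apply/bitstream_openP => y /cylinder_sym <-; exists N. Qed.

(** The sequences with finitely many ones, a countable dense set. *)
Definition bits_of_nat (w : nat) : nat -> bool := fun i => odd (w %/ 2 ^ i).

Lemma bits_of_nat_dense N x : exists w, cylinder N x (bits_of_nat w).
Proof.
suff [w _ ?] : exists2 w, (w < 2 ^ N)%N & cylinder N x (bits_of_nat w).
  by exists w.
elim: N => [|N [w wN h]]; first by exists 0%N.
exists (w + x N * 2 ^ N)%N; first by rewrite expnS; case: (x N); lia.
move=> i; rewrite ltnS leq_eqVlt => /predU1P[->|iN]; rewrite /bits_of_nat.
  by rewrite divnDMl ?expn_gt0 // divn_small // add0n; case: (x N).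
rewrite -(subnK (ltnW iN)) expnD mulnA divnDMl ?expn_gt0 // oddD oddM oddX.
by rewrite subn_eq0 leqNgt iN /= andbF addbF -h.
Qed.

Lemma bitstream_second_countable (R : realType) :
  @second_countable (bitstream R).
Proof.
exists (range (fun p : nat * nat => cylinder p.1 (bits_of_nat p.2))).
  by apply: sub_countable (card_image_le _ _) _; exact: countableP.
split=> [_ [p _ <-]|x A [N NA]]; first exact: open_cylinder.
have [w hw] := bits_of_nat_dense N x; exists (cylinder N (bits_of_nat w)).
  by split; [exists (N, w)|move=> i iN; rewrite hw].
by rewrite (cylinder_sym hw).
Qed.

(** * The fair coin-tossing measure *)

Notation bit_space R := (g_sigma_algebraType (@open (bitstream R))).

Lemma bit_space_standard (R : realType) : standard_Borel R (bit_space R).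
Proof.
exists (bitstream R), id; split.
- exact: bitstream_hausdorff.
- exact: bitstream_second_countable.
- by exists id.
- by move=> A; rewrite image_id.
Qed.

(** Prefix lengths are multiples of [d], so that all [d] coordinates are truncated at the same
    level; the empty set is there for closure under intersection. *)
Definition cylinders (d : nat) : set (set (nat -> bool)) :=
  [set A | A = set0 \/ exists K x, A = cylinder (d * K) x].

(** Two cylinders are disjoint or nested. *)
Lemma cylinders_setI d : setI_closed (cylinders d).
Proof.
have aux N M x y : (N <= M)%N -> cylinder N x `&` cylinder M y = set0 \/
    cylinder N x `&` cylinder M y = cylinder M y.
  move=> NM; have [->|/set0P[z [h1 h2]]] := eqVneq (cylinder N x `&` cylinder M y) set0.
    by left.
  right; apply/setIidPr => w; rewrite -(cylinder_sym h2) -(cylinder_sym h1).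
  exact: sub_cylinder.
move=> _ _ [->|[K [x ->]]] [->|[L [y ->]]]; rewrite ?set0I ?setI0; try by left.
have [KL|/ltnW LK] := leqP (d * K)%N (d * L)%N.
  by have [] := aux _ _ x y KL; [left|right; exists L, y].
by rewrite setIC; have [] := aux _ _ y x LK; [left|right; exists K, x].
Qed.

Lemma open_bigcup_cylinder (R : realType) d (A : set (bitstream R)) : open A ->
  A = \bigcup_(p in [set p : nat * nat |
        cylinder (d.+1 * p.1) (bits_of_nat p.2) `<=` A])
      cylinder (d.+1 * p.1) (bits_of_nat p.2).
Proof.
move=> /bitstream_openP oA; apply/seteqP; split=> [x /oA[N NA]|x [p]]; last exact.
have [w hw] := bits_of_nat_dense (d.+1 * N) x.
exists (N, w) => /=; last by move=> i iN; rewrite hw.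
rewrite (cylinder_sym hw); apply: subset_trans NA.
by apply: sub_cylinder; rewrite leq_pmull.
Qed.

Lemma measurable_cylinder (R : realType) N x :
  measurable (cylinder N x : set (bit_space R)).
Proof. by apply: sub_sigma_algebra; exact: open_cylinder. Qed.

(** An open set is a countable union of cylinders around finitely supported points. This π-system
    serves for measurability of maps and for uniqueness of measures. *)
Lemma measurable_bit_spaceE (R : realType) d :
  (@measurable _ (bit_space R)) = <<s cylinders d.+1 >>.
Proof.
apply/seteqP; split; apply: smallest_sub; do ?exact: smallest_sigma_algebra.
- move=> A /(open_bigcup_cylinder d) ->.
  rewrite bigcup_mkcond; apply: (@countable_bigcupT_measurable _
    (g_sigma_algebraType (cylinders d.+1))) => // p.
  case: ifP => _; last exact: measurable0.
  by apply: sub_sigma_algebra; right; exists p.1, (bits_of_nat p.2).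
- move=> A [->|[K [x ->]]]; first exact: measurable0.
  exact: measurable_cylinder.
Qed.

Definition binary_digits (R : realType) (t : R) : bitstream R :=
  fun i => odd (Num.truncn (2 ^+ i.+1 * t)).

Lemma measurable_truncn_scale (R : realType) (c : R) (B : set nat) :
  measurable [set t : measurableTypeR R | B (Num.truncn (c * t))].
Proof.
have mS n : measurable [set t : measurableTypeR R | (n < Num.truncn (c * t))%N].
  rewrite [X in measurable X](_ : _ =
    setT `&` ( *%R c) @^-1` `[n.+1%:R, +oo[); last first.
    by apply/seteqP; split=> t /=; rewrite truncn_gt_nat in_itv /= andbT //; case.
  by apply: mulrl_measurable => //; exact: measurable_itv.
have mE n : measurable [set t : measurableTypeR R | Num.truncn (c * t) = n].
  rewrite [X in measurable X](_ : _ = (if n is k.+1 then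
      [set t | (k < Num.truncn (c * t))%N] else setT) `\`
      [set t | (n < Num.truncn (c * t))%N]).
    by apply: measurableD => //; case: n.
  by apply/seteqP; split=> t /=; case: n => [|n] /=; [split|split|..]; lia.
rewrite [X in measurable X](_ : _ = \bigcup_(n in B)
  [set t : measurableTypeR R | Num.truncn (c * t) = n]).
  exact: bigcup_measurable.
by apply/seteqP; split=> t /= => [Bt|[n Bn ->//]]; exists (Num.truncn (c * t)).
Qed.

Lemma measurable_binary_digits (R : realType) :
  measurable_fun setT (@binary_digits R : measurableTypeR R -> bit_space R).
Proof.
apply: (measurability _ (measurable_bit_spaceE R 0)).
move=> _ [_ [->|[K [x ->]]] <-]; first by rewrite preimage_set0 setI0.
rewrite setTI [X in measurable X](_ : _ = \bigcap_(i in [set i | (i < 1 * K)%N])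
  [set t : measurableTypeR R | [set n | odd n = x i] (Num.truncn (2 ^+ i.+1 * t))]).
  by apply: bigcap_measurableType => i _; exact: measurable_truncn_scale.
by apply/seteqP; split=> t h i; exact: h.
Qed.

(** Most significant bit first, unlike [coord_val]: this is the index of the dyadic interval of
    length [2 ^- N] whose points have the given first digits. *)
Fixpoint prefix_code (N : nat) (x : nat -> bool) : nat :=
  if N is M.+1 then (prefix_code M x).*2 + x M else 0.

Lemma half_truncn (R : realType) (s : R) : 0 <= s ->
  (Num.truncn (2 * s))./2 = Num.truncn s.
Proof.
move=> s0; apply/esym/truncn_def.
have /truncn_itv : 0 <= 2 * s by rewrite mulr_ge0.
set v := Num.truncn (2 * s) => /andP[h1 h2].
have e : v%:R = (odd v)%:R + 2 * (v./2)%:R :> R.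
  by rewrite -{1}(odd_double_half v) natrD -mul2n natrM.
have : v.+1%:R = (odd v)%:R + 2 * (v./2)%:R + 1 :> R by rewrite -natr1 e.
by case: (odd v) e => /= e e'; apply/andP; split; rewrite -?natr1; lra.
Qed.

Lemma binary_digits_prefix (R : realType) N x (t : R) : 0 <= t < 1 ->
  cylinder N x (binary_digits t) <-> Num.truncn (2 ^+ N * t) = prefix_code N x.
Proof.
move=> /andP[t0 t1]; elim: N => [|N IH].
  by rewrite expr0 mul1r; split=> // _; apply: truncn_def; rewrite t0.
have half : (Num.truncn (2 ^+ N.+1 * t))./2 = Num.truncn (2 ^+ N * t).
  by rewrite exprS -mulrA half_truncn // mulr_ge0 // exprn_ge0.
split=> /= [h|h i].
  have /IH <- : cylinder N x (binary_digits t) by move=> i iN; apply: h; exact: ltnW.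
  by rewrite -half -(h N) // /binary_digits addnC odd_double_half.
have hN : odd (Num.truncn (2 ^+ N.+1 * t)) = x N.
  by rewrite h oddD odd_double /=; case: (x N).
have /IH {}IH : Num.truncn (2 ^+ N * t) = prefix_code N x.
  by rewrite -half h addnC half_bit_double.
by rewrite ltnS leq_eqVlt => /predU1P[->//|]; exact: IH.
Qed.

Lemma prefix_code_lt N x : (prefix_code N x < 2 ^ N)%N.
Proof. by elim: N => //= N IH; rewrite expnS; case: (x N); lia. Qed.

Lemma binary_digits_cylinder (R : realType) N x :
  (@binary_digits R) @^-1` cylinder N x `&` `[0, 1[%classic =
  `[(prefix_code N x)%:R / 2 ^+ N, (prefix_code N x).+1%:R / 2 ^+ N[%classic.
Proof.
have p : 0 < 2 ^+ N :> R by rewrite exprn_gt0.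
apply/seteqP; split=> t /=; rewrite !in_itv /= ler_pdivrMr // ltr_pdivlMr //.
  move=> [h /[dup] t01 /andP[t0 _]]; rewrite mulrC -truncn_eq.
    by apply/eqP/(binary_digits_prefix _ _ t01).
  by rewrite mulr_ge0 // ltW.
move=> /andP[h1 h2]; have t01 : 0 <= t < 1.
  apply/andP; split.
    by rewrite -(pmulr_lge0 _ p); apply: le_trans h1.
  rewrite -(ltr_pM2r p) mul1r; apply: lt_le_trans h2 _.
  by rewrite -natrX ler_nat prefix_code_lt.
split=> //; apply/(binary_digits_prefix _ _ t01); apply/truncn_def.
by rewrite mulrC h1.
Qed.

(** Coin tossing, realised as the binary digits of a uniform random point of [[0, 1[]. *)
Definition fair_measure (R : realType) : set (bit_space R) -> \bar R :=
  fun A => lebesgue_measure (@binary_digits R @^-1` A `&` `[0, 1[%classic).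

Lemma fair_measure0 (R : realType) : @fair_measure R set0 = 0%E.
Proof. by rewrite /fair_measure preimage_set0 set0I measure0. Qed.

Lemma fair_measure_ge0 (R : realType) A : (0 <= @fair_measure R A)%E.
Proof. exact: measure_ge0. Qed.

Lemma fair_measure_sigma_additive (R : realType) :
  semi_sigma_additive (@fair_measure R).
Proof.
move=> F mF tF mUF; rewrite /fair_measure preimage_bigcup setI_bigcupl.
have mD A : measurable A ->
    measurable ((@binary_digits R : measurableTypeR R -> bit_space R) @^-1` A).
  by move=> mA; rewrite -[X in measurable X]setTI; exact: measurable_binary_digits.
apply: measure_sigma_additive => [n|].
  by apply: measurableI; [exact: mD|exact: measurable_itv].
apply/trivIsetP => i j _ _ ij; move/trivIsetP : tF => /(_ i j Logic.I Logic.I ij) tF.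
by rewrite setIACA -preimage_setI tF preimage_set0 set0I.
Qed.

HB.instance Definition _ (R : realType) := isMeasure.Build _ _ _
  (@fair_measure R) (fair_measure0 R) (@fair_measure_ge0 R)
  (@fair_measure_sigma_additive R).

Lemma fair_measure_cylinder (R : realType) N x :
  fair_measure (cylinder N x) = (2 ^- N)%:E :> \bar R.
Proof.
rewrite /fair_measure binary_digits_cylinder.
rewrite lebesgue_measure_itv /= lte_fin ltr_pM2r ?invr_gt0 ?exprn_gt0 //.
by rewrite ltr_nat ltnSn -EFinB -mulrBl -natrB // subSnn mul1r.
Qed.

Lemma fair_measure_setT (R : realType) : fair_measure setT = 1%E :> \bar R.
Proof.
rewrite -[X in fair_measure X](_ : cylinder 0 (fun=> false) = _).
  by rewrite fair_measure_cylinder expr0 invr1.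
by apply/seteqP; split.
Qed.

HB.instance Definition _ (R : realType) :=
  Measure_isProbability.Build _ _ R (@fair_measure R) (fair_measure_setT R).

(** * The coupling *)

Lemma odometerK r (g : 'rV[int]_r.+1) : cancel (odometer g) (odometer (- g)).
Proof. by move=> x; apply/funext => i; rewrite -odometerD addNr odometer0. Qed.

(** Carries only move upwards: the first [K] digits of each translated coordinate depend only on
    residues modulo [2 ^ K]. *)
Lemma odometer_prefix r (g : 'rV[int]_r.+1) K x y :
  cylinder (r.+1 * K) x y ->
  cylinder (r.+1 * K) (odometer g x) (odometer g y).
Proof.
move=> /coord_val_prefix h; apply/coord_val_prefix => j jr.
by apply/eqP; rewrite -eqz_nat !coord_val_odometer // h.
Qed.

Lemma odometer_preimage_cylinder r (g : 'rV[int]_r.+1) K x :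
  odometer g @^-1` cylinder (r.+1 * K) x = cylinder (r.+1 * K) (odometer (- g) x).
Proof.
apply/seteqP; split=> y /= /(odometer_prefix _) h.
  by have := h (- g); rewrite odometerK.
by have := h g; rewrite -{1}[g]opprK odometerK.
Qed.

Lemma measurable_odometer (R : realType) r (g : 'rV[int]_r.+1) :
  measurable_fun setT (odometer g : bit_space R -> bit_space R).
Proof.
apply: (measurability _ (measurable_bit_spaceE R r)).
move=> _ [_ [->|[K [x ->]]] <-]; first by rewrite preimage_set0 setI0.
by rewrite setTI odometer_preimage_cylinder; exact: measurable_cylinder.
Qed.

(** A translation permutes the cylinders of each level, which have equal measure, and these
    cylinders form a generating π-system. *)
Lemma odometer_preserves (R : realType) r (g : 'rV[int]_r.+1)
    (A : set (bit_space R)) : measurable A ->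
  fair_measure (odometer g @^-1` A) = fair_measure A.
Proof.
move=> mA; pose f := odometer g : bit_space R -> bit_space R.
pose fm := isMeasurableFun.Build _ _ _ _ f (measurable_odometer g).
pose F : {mfun bit_space R >-> bit_space R} := HB.pack f fm.
change (distribution (@fair_measure R) F A = fair_measure A).
apply: (@measure_unique _ R (bit_space R) (cylinders r.+1) (fun=> setT)
  (measurable_bit_spaceE R r) (@cylinders_setI r.+1) _ _ (distribution (@fair_measure R) F) (@fair_measure R)) => //.
- by move=> _; right; exists 0%N, (fun=> false); apply/seteqP; split=> // x _ i; rewrite muln0.
- by apply/seteqP; split=> // x _; exists 0%N.
- move=> _ [->|[K [x ->]]]; first by rewrite !measure0.
  change (fair_measure (odometer g @^-1` cylinder (r.+1 * K) x) =
    @fair_measure R (cylinder (r.+1 * K) x)).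
  rewrite odometer_preimage_cylinder.
  by rewrite !fair_measure_cylinder.
- by move=> _; rewrite (le_lt_trans (probability_le1 _ _)) ?ltry.
Qed.

Lemma odometer_pmp (R : realType) r :
  pmp_action (@fair_measure R) (@odometer r).
Proof.
split=> [x|g h x|g|g A].
- by apply/funext => i; rewrite odometer0.
- by apply/funext => i; rewrite odometerD.
- exact: measurable_odometer.
- exact: odometer_preserves.
Qed.

Lemma odometer_essentially_free (R : realType) r :
  essentially_free (@fair_measure R) (@odometer r).
Proof. by apply: aeW => x g gx; apply: (@odometer_free _ _ x); rewrite gx. Qed.

(** * Probability of a carry *)

Definition level (r j K v : nat) : set (nat -> bool) :=
  [set x | coord_val r j K x = v].

Lemma measurable_prefix_set (R : realType) N (A : set (nat -> bool)) :
  (forall x y, cylinder N x y -> A x -> A y) ->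
  measurable (A : set (bit_space R)).
Proof.
move=> h; apply: sub_sigma_algebra; apply/bitstream_openP => x Ax.
by exists N => y xy; apply: h Ax.
Qed.

Lemma measurable_coord_val (R : realType) r j K (B : set nat) : (j < r.+1)%N ->
  measurable ([set x | B (coord_val r j K x)] : set (bit_space R)).
Proof.
move=> jr; apply: (@measurable_prefix_set _ (r.+1 * K)) => x y.
by move=> /coord_val_prefix h /=; rewrite h.
Qed.

Lemma measurable_level (R : realType) r j K v : (j < r.+1)%N ->
  measurable (level r j K v : set (bit_space R)).
Proof. exact: (@measurable_coord_val R r j K [set v]). Qed.

(* The translation by v along the j-th axis carries level 0 to level v, so the
   2^K levels, which partition the space, have the same measure. *)
Lemma fair_measure_level (R : realType) r j K v : (j < r.+1)%N ->
  (fair_measure (level r j K v : set (bit_space R)) <= (2 ^- K)%:E)%E.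
Proof.
move=> jr.
have [vK|Kv] := ltnP v (2 ^ K); last first.
  rewrite [level _ _ _ _](_ : _ = set0) ?measure0 ?lee_fin ?invr_ge0 //.
  by apply/seteqP; split=> // x /=; rewrite /level /=; have := coord_val_lt r j K x; lia.
have same w : (w < 2 ^ K)%N ->
    @fair_measure R (level r j K w) = fair_measure (level r j K 0).
  move=> wK; pose g : 'rV[int]_r.+1 := w%:Z *: delta_mx 0 (inord j).
  rewrite -(odometer_preserves g); last exact: measurable_level.
  congr fair_measure; apply/seteqP; rewrite /level.
  have E x : coord_val r j K (odometer g x) = ((coord_val r j K x + w) %% 2 ^ K)%N.
    apply/eqP; rewrite -eqz_nat coord_val_odometer // !mxE !eqxx mulr1.
    by rewrite -PoszD modz_nat.
  split=> x /=; rewrite E; last by move=> ->; rewrite modn_small.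
  rewrite -{2}(modn_small wK) => /eqP; rewrite -{2}[w]add0n eqn_modDr mod0n.
  by rewrite modn_small ?coord_val_lt // => /eqP.
have [p pE] : exists p, @fair_measure R (level r j K 0) = p%:E.
  exists (fine (fair_measure (level r j K 0))); rewrite fineK //.
  by apply: fin_num_measure; exact: measurable_level.
have : (1 = \sum_(w < 2 ^ K) @fair_measure R (level r j K w))%E.
  rewrite -measure_bigsetU_ord.
  - rewrite -(@fair_measure_setT R); congr fair_measure.
    rewrite -(bigcup_mkord _ (level r j K)); apply/seteqP; split=> // x _.
    by exists (coord_val r j K x) => //; exact: coord_val_lt.
  - by move=> w; exact: measurable_level.
  - by apply/trivIsetP => u w _ _ /eqP uw; apply/seteqP; split=> // x [] /= h1 h2; case: uw; apply: val_inj; rewrite /= -h1.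
rewrite (eq_bigr (fun=> p%:E)) => [|w _]; last by rewrite same.
rewrite sumEFin sumr_const card_ord => -[e].
rewrite same // pE lee_fin -[leRHS]mul1r ler_pdivlMr ?exprn_gt0 //.
by rewrite [leRHS]e -[leRHS]mulr_natr natrX.
Qed.

(** Both overflow and, for negative entries of [g], borrowing beyond the first [K] digits. *)
Definition carries (r K : nat) (g : 'rV[int]_r.+1) : set (nat -> bool) :=
  [set x | exists j : 'I_r.+1,
     ~~ (0 <= (coord_val r j K x)%:Z + g 0 j < (2 ^ K)%N%:Z)].

Definition l1_norm (r : nat) (g : 'rV[int]_r.+1) : nat :=
  (\sum_(j < r.+1) `|g 0%R j|)%N.

Lemma measurable_carries (R : realType) r K (g : 'rV[int]_r.+1) :
  measurable (carries K g : set (bit_space R)).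
Proof.
apply: (@measurable_prefix_set _ (r.+1 * K)) => x y.
by move=> /coord_val_prefix h [j xj]; exists j; rewrite h.
Qed.

(** Union bound: in a coordinate where [g] has entry [z], at most [|z|] residues lead out of the
    range, each of probability at most [2 ^- K]. *)
Lemma fair_measure_carries (R : realType) r K (g : 'rV[int]_r.+1) :
  (fair_measure (carries K g : set (bit_space R)) <=
   ((l1_norm g)%:R * 2 ^- K)%:E)%E.
Proof.
pose B (z : int) : set nat := [set v | ~~ (0 <= v%:Z + z < (2 ^ K)%N%:Z)].
pose C j : set (bit_space R) := [set x | B (g 0 (inord j)) (coord_val r j K x)].
have mC j : (j < r.+1)%N -> measurable (C j) by exact: measurable_coord_val.
have Cle j : (j < r.+1)%N ->
    (fair_measure (C j) <= (`|g 0%R (inord j)|%N%:R * 2 ^- K)%:E)%E.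
  move=> jr; set z := g 0 (inord j).
  (* The bad residues are the [z] largest ones if [z] is nonnegative, and the [|z|] smallest ones
     otherwise. *)
  pose F i : set (bit_space R) :=
    level r j K (if (0 <= z)%R then (2 ^ K).-1 - i else i)%N.
  apply: le_trans (_ : _ <= \sum_(i < `|z|%N) fair_measure (F i))%E _.
    apply: content_subadditive => [i _| |x].
    - exact: measurable_level.
    - exact: mC.
    - rewrite /C /B /= -/z => xB; rewrite -(bigcup_mkord _ F) /=.
      have xK := coord_val_lt r j K x; have [z0|z0] := lerP 0 z.
        exists ((2 ^ K).-1 - coord_val r j K x)%N; first by rewrite /=; lia.
        by rewrite /F /level /= z0; lia.
      exists (coord_val r j K x); first by rewrite /=; lia.
      by rewrite /F /level /= leNgt z0.
  apply: (@le_trans _ _ (\sum_(i < `|z|%N) (2 ^- K)%:E)%E).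
    by apply: lee_sum => i _; exact: fair_measure_level.
  by rewrite sumEFin sumr_const card_ord mulr_natl.
apply: le_trans (_ : _ <= \sum_(j < r.+1) fair_measure (C j))%E _.
  apply: content_subadditive => [j jr| |x [j xj]].
  - exact: mC.
  - exact: measurable_carries.
  - by rewrite -(bigcup_mkord _ C); exists (val j) => //=; rewrite /C /B /= inord_val.
apply: (@le_trans _ _
    (\sum_(j < r.+1) (`|g 0%R j|%N%:R * 2 ^- K)%:E)%E).
  by apply: lee_sum => j _; have := Cle j (ltn_ord j); rewrite inord_val.
by rewrite sumEFin -mulr_suml lee_fin /l1_norm natr_sum.
Qed.

Lemma carries_negligible (R : realType) r (g : 'rV[int]_r.+1) :
  (@fair_measure R).-negligible (\bigcap_K carries K g).
Proof.
have mC : measurable (\bigcap_K carries K g : set (bit_space R)).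
  by apply: bigcap_measurableType => K _; exact: measurable_carries.
suff z : @fair_measure R (\bigcap_K carries K g) = 0%E.
  by exists (\bigcap_K carries K g); split.
have le K : (@fair_measure R (\bigcap_K carries K g) <=
    ((l1_norm g)%:R * 2 ^- K)%:E)%E.
  apply: le_trans (fair_measure_carries _ _ _); apply: le_measure.
  - by rewrite inE.
  - by rewrite inE; exact: measurable_carries.
  - by move=> x; apply.
have : (0 <= @fair_measure R (\bigcap_K carries K g))%E by exact: measure_ge0.
have : (@fair_measure R (\bigcap_K carries K g) \is a fin_num).
  exact: fin_num_measure.
case: (fair_measure _) le => // e le _.
rewrite lee_fin le_eqVlt => /predU1P[<-//|e0].
(* A positive measure [e] would give [2 ^ K <= l1_norm g / e < K] for this [K]. *)
pose K := (Num.truncn ((l1_norm g)%:R / e)).+1.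
have := le K; rewrite lee_fin ler_pdivlMr ?exprn_gt0 // mulrC -ler_pdivlMr //.
move=> h; have : (2 ^ K)%:R < K%:R :> R.
  by rewrite natrX; apply: le_lt_trans h (truncnS_gt _).
by rewrite ltr_nat ltnNge (ltnW (ltn_expl _ _)).
Qed.

(** Without a carry, [x] and its translate agree from index [r.+1 * K] on, so [odometer_of_tail_eq]
    applies in dimension [s.+1]. *)
Lemma odometer_shift r s (g : 'rV[int]_r.+1) K x : ~ carries K g x ->
  exists2 h : 'rV[int]_s.+1, odometer h x = odometer g x &
    forall j, (`|h 0%R j| <= 2 ^ ((r.+1 * K) %/ s.+1).+1)%N.
Proof.
move=> nc.
have tail i : (r.+1 * K <= i)%N -> x i = odometer g x i.
  move=> Ki; rewrite (@odometer_no_carry _ _ _ K) // => j.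
  by apply/negPn/negP => xj; apply: nc; exists j.
(* The successor rounds the quotient up, so that whole levels cover the first [r.+1 * K] bits. *)
have NK : (r.+1 * K <= s.+1 * ((r.+1 * K) %/ s.+1).+1)%N.
  by rewrite [leqRHS]mulnC ltnW // ltn_ceil.
have [h hx hle] := odometer_of_tail_eq NK tail.
by exists h => //; apply/funext.
Qed.

(** For each [g], almost every point has a level without carry. As the groups are countable, one
    null set serves for all [g] and both inclusions. *)
Lemma odometer_orbits (R : realType) r s :
  {ae @fair_measure R, forall x,
    orbit_of (@odometer r) x = orbit_of (@odometer s) x}.
Proof.
have H r' : (@fair_measure R).-negligible
    (\bigcup_(g : 'rV[int]_r'.+1) \bigcap_K carries K g).
  pose F k : set (bit_space R) :=
    if unpickle k is Some g then \bigcap_K @carries r' K g else set0.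
  suff nF : (@fair_measure R).-negligible (\bigcup_k F k).
    apply: negligibleS nF => x [g _ xg].
    by exists (pickle g) => //; rewrite /F pickleK.
  apply: negligible_bigcup => k; rewrite /F; case: unpickle => [g|].
    exact: carries_negligible.
  exact: negligible_set0.
have sub r' s' x : ~ (\bigcup_(g : 'rV[int]_r'.+1) \bigcap_K carries K g) x ->
    orbit_of (@odometer r') x `<=` orbit_of (@odometer s') x.
  move=> nx _ [g _ <-].
  have [K nc] : exists K, ~ carries K g x.
    by apply/existsNP => h; apply: nx; exists g.
  by have [h hx _] := odometer_shift s' nc; exists h.
apply: negligibleS (negligibleU (H r) (H s)) => x /= h.
apply: contrapT => /not_orP [h1 h2]; apply: h.
by apply/seteqP; split; exact: sub.
Qed.

Definition odometer_coupling (R : realType) (r s : nat) :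
    oe_coupling R 'rV[int]_r.+1 'rV[int]_s.+1 :=
  OECoupling (bit_space_standard R) (odometer_pmp R r) (odometer_pmp R s)
    (odometer_essentially_free R r) (odometer_essentially_free R s)
    (odometer_orbits R r s).

(** * Word lengths and integration by layers *)

Lemma min_nat_le (A : set nat) k : A k -> (min_nat A <= k)%N.
Proof.
move=> Ak.
have exA : exists j, `[< A j >] by exists k; apply/asboolP.
rewrite /min_nat; case: xgetP => [j _ [_ h]|h]; first exact: h.
have [j /asboolP Aj jmin] := ex_minnP exA.
by case: (h j); split=> // i Ai; apply: jmin; apply/asboolP.
Qed.

Lemma orbit_dist_le (T : Type) (G : zmodType) (S : set G) (a : G -> T -> T) g x y :
  a g x = y -> (orbit_dist S a x y <= word_length S g)%N.
Proof. by move=> gx; apply: min_nat_le; exists g. Qed.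

(** An upper bound on word length in a form that adds up under sums of group elements. *)
Definition reachable (G : zmodType) (S : set G) (L : nat) (g : G) : Prop :=
  exists2 w, words S w & \sum_(s <- w) s = g /\ (size w <= L)%N.

Lemma word_length_le (G : zmodType) (S : set G) L g :
  reachable S L g -> (word_length S g <= L)%N.
Proof.
move=> [w Sw [wg wL]]; apply: leq_trans wL; apply: min_nat_le.
by exists w.
Qed.

Lemma reachable0 (G : zmodType) (S : set G) : reachable S 0 0.
Proof. by exists [::] => //; split; rewrite ?big_nil. Qed.

Lemma reachableD (G : zmodType) (S : set G) K L g h :
  reachable S K g -> reachable S L h -> reachable S (K + L) (g + h).
Proof.
move=> [v Sv [<- vK]] [w Sw [<- wL]]; exists (v ++ w).
  by move=> s; rewrite mem_cat => /orP[/Sv|/Sw].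
by split; [rewrite big_cat|rewrite size_cat leq_add].
Qed.

Lemma reachableN (G : zmodType) (S : set G) L g :
  (forall s, S s -> S (- s)) -> reachable S L g -> reachable S L (- g).
Proof.
move=> SN [w Sw [<- wL]]; exists (map -%R w).
  by move=> _ /mapP[s /Sw Ss ->]; exact: SN.
by split; [rewrite big_map sumrN|rewrite size_map].
Qed.

Lemma reachableMz (G : zmodType) (S : set G) L g (z : int) :
  (forall s, S s -> S (- s)) -> reachable S L g ->
  reachable S (`|z| * L)%N (g *~ z).
Proof.
move=> SN gL.
have nat_mul n : reachable S (n * L)%N (g *+ n).
  by elim: n => [|n IH]; [exact: reachable0|rewrite mulrS mulSn; exact: reachableD].
by case: z => n; [exact: nat_mul|apply: reachableN].
Qed.

(** Each standard basis vector is spelled by a word [w j]; expanding [h] in this basis costs at most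
    [b] copies of each word or its inverse. *)
Lemma word_length_box r (S : set 'rV[int]_r.+1) : symmetric_generating S ->
  exists C : nat, forall (b : nat) (h : 'rV[int]_r.+1),
    (forall j, (`|h 0%R j| <= b)%N) -> (word_length S h <= C * b)%N.
Proof.
move=> [_ SN gen].
have /choice[w wE] : forall j : 'I_r.+1, exists w,
    words S w /\ \sum_(s <- w) s = delta_mx 0 j.
  by move=> j; have [w] := gen (delta_mx 0 j); exists w.
exists (\sum_(j < r.+1) size (w j))%N => b h hb; apply: word_length_le.
have -> : h = \sum_(j < r.+1) delta_mx 0 j *~ h 0 j.
  rewrite {1}[h]row_sum_delta; apply: eq_bigr => j _.
  by rewrite -[in LHS](intz (h 0 j)) scaler_int.
rewrite big_distrl /=.
elim/big_ind2: _ => [|K g L f|j _]; [exact: reachable0|exact: reachableD|].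
have [Sw we] := wE j.
have /(reachableMz (h 0 j) SN) : reachable S (size (w j)) (delta_mx 0 j).
  by exists (w j).
move=> [v Sv [vE vs]]; exists v => //; split=> //.
by apply: leq_trans vs _; rewrite mulnC leq_mul2l hb orbT.
Qed.

(** The integral of a nonnegative function is a supremum over simple functions below it, hence
    monotone for arbitrary functions. This serves for the orbit distance, whose measurability is not
    at hand. *)
Lemma le_integralT (R : realType) d (T : measurableType d)
    (mu : {measure set T -> \bar R}) (f g : T -> \bar R) :
  (forall x, 0 <= f x)%E -> (forall x, f x <= g x)%E ->
  (\int[mu]_x f x <= \int[mu]_x g x)%E.
Proof.
move=> f0 fg; have g0 x : (0 <= g x)%E by exact: le_trans (fg x).
rewrite !ge0_integralTE //; apply: le_ereal_sup => _ [h hf <-]; exists h => // x.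
exact: le_trans (fg x).
Qed.

Lemma sum_expr_le (R : realType) (x : R) n : 0 <= x < 1 ->
  \sum_(k < n) x ^+ k <= (1 - x)^-1.
Proof.
move=> /andP[x0 x1]; have x1' : 0 < 1 - x by rewrite subr_gt0.
elim: n => [|n IH]; first by rewrite big_ord0 invr_ge0 ltW.
rewrite big_ord_recl expr0; under eq_bigr do rewrite /bump /= exprS.
rewrite -mulr_sumr; apply: (@le_trans _ _ (1 + x * (1 - x)^-1)).
  by rewrite lerD2l ler_wpM2l.
by rewrite -{1}(divff (lt0r_neq0 x1')) -mulrDl subrK mul1r.
Qed.

(** If [L] is the first index with [x] outside [B L.+1], then [x] lies in [B L] and [f x <= p L]. So
    [f] is dominated by a series of multiples of indicators of the layers, which is integrated
    termwise. *)
Lemma integral_layers_finite (R : realType) d (T : measurableType d)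
    (P : {measure set T -> \bar R}) (B : nat -> set T) (p : nat -> R)
    (c M : R) (f : T -> R) :
  (forall K, measurable (B K)) -> B 0%N = setT -> 0 <= c ->
  (forall K, (P (B K) <= (c * 2 ^- K)%:E)%E) ->
  (forall x, 0 <= f x) -> (forall K, 0 <= p K) ->
  (forall K x, ~ B K.+1 x -> f x <= p K) ->
  (forall n, \sum_(K < n) p K * 2 ^- K <= M) ->
  (\int[P]_x (f x)%:E < +oo)%E.
Proof.
move=> mB B0 c0 PB f0 p0 fp pM.
(* The added 1 makes the series diverge at points lying in all layers, where no [p K] bounds [f]. *)
pose g K x := ((p K + 1) * \1_(B K) x : R).
have g0 K x : 0 <= g K x by rewrite mulr_ge0 // addr_ge0.
have fg x : ((f x)%:E <= \sum_(0 <= K <oo) (g K x)%:E)%E.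
  suff [n fn] : exists n, f x <= \sum_(K < n) g K x.
    apply: le_trans (nneseries_lim_ge n _); last by move=> K _ _; rewrite lee_fin.
    by rewrite big_mkord sumEFin lee_fin.
  have [[K xK]|all] := pselect (exists K, ~ B K.+1 x).
    have exK : exists K, `[< ~ B K.+1 x >] by exists K; apply/asboolP.
    have [L /asboolP xL Lmin] := ex_minnP exK.
    have BL : B L x.
      case: L xL Lmin => [|L] _ Lmin; first by rewrite B0.
      apply: contrapT => h; suff: (L < L)%N by rewrite ltnn.
      by apply: Lmin; apply/asboolP.
    exists L.+1; rewrite big_ord_recr /=; apply: ler_wpDl; first exact: sumr_ge0.
    rewrite /g indicE mem_set // mulr1; apply: le_trans (fp _ _ xL) _.
    by rewrite lerDl.
  have {}all K : B K x.
    by case: K => [|K]; [rewrite B0|apply: contrapT => h; apply: all; exists K].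
  exists (Num.truncn (f x)).+1; apply: le_trans (ltW (truncnS_gt _)) _.
  rewrite -[X in X%:R]card_ord -sumr_const; apply: ler_sum => K _.
  by rewrite /g indicE mem_set // mulr1 lerDr.
apply: le_lt_trans (le_integralT P _ fg) _; first by move=> x; rewrite lee_fin.
rewrite integral_nneseries //; last 2 first.
- move=> K; apply/measurable_EFinP; apply: measurable_funM => //.
- by move=> K x _; rewrite lee_fin.
(* [M] accounts for the terms [p K], and 2 is the sum of the geometric series coming from the added
   1. *)
apply: (@le_lt_trans _ _ (c * (M + 2))%:E); last exact: ltry.
have gi K : (\int[P]_x (g K x)%:E <= ((p K + 1) * (c * 2 ^- K))%:E)%E.
  rewrite /g; under eq_integral do rewrite EFinM.
  rewrite ge0_integralZl //; last 2 first.
  - by apply/measurable_EFinP.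
  - by rewrite lee_fin addr_ge0.
  rewrite integral_indic // setIT EFinM; apply: lee_wpmul2l => //.
  by rewrite lee_fin addr_ge0.
apply: lime_le.
  by apply: is_cvg_nneseries => K _ _; apply: integral_ge0 => x _; rewrite lee_fin.
apply: nearW => n; rewrite big_mkord.
apply: (@le_trans _ _ (\sum_(K < n) ((p K + 1) * (c * 2 ^- K))%:E)%E).
  by apply: lee_sum => K _; exact: gi.
rewrite sumEFin lee_fin.
under eq_bigr do rewrite mulrCA mulrDl mul1r.
rewrite -mulr_sumr big_split /=; apply: ler_wpM2l => //; apply: lerD; first exact: pM.
have h : 0 <= (2^-1 : R) < 1 by apply/andP; split; lra.
under eq_bigr do rewrite -exprVn.
apply: le_trans (sum_expr_le n h) _.
by have -> : 1 - 2^-1 = 2^-1 :> R; [lra|rewrite invrK].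
Qed.

(** * Summability of the rates *)

(* By convexity, (1 + 1/k)^e >= 1 + e ln (1 + 1/k) and ln (1 + 1/k) >= 1/(k+1). *)
Lemma riemannR_telescope (R : realType) (e : R) (k : nat) : 0 < e ->
  riemannR (1 + e) k.+1 <= e^-1 * (k.+1%:R `^ (- e) - k.+2%:R `^ (- e)).
Proof.
move=> e0; pose a : R := k.+1%:R; pose b : R := k.+2%:R.
have a0 : 0 < a by rewrite ltr0n.
have b0 : 0 < b by rewrite ltr0n.
have ab : a = b - 1 by rewrite /b -natr1 addrK.
rewrite /riemannR -/a -/b -powRN opprD powRD ?(gt_eqF b0) ?implybT //.
rewrite powR_inv1 ?(ltW b0) //.
have -> : a `^ (- e) = b `^ (- e) * (a / b) `^ (- e).
  by rewrite -powRM ?divr_ge0 ?ltW // mulrC divfK // gt_eqF.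
have lnab : ln (a / b) <= - b^-1.
  have -> : a / b = 1 + - b^-1 by rewrite ab mulrBl mul1r divff // gt_eqF.
  apply: le_ln1Dx; rewrite ltrN2 invf_lt1 //.
  by rewrite /b -[1]/(1%:R) ltr_nat.
have : 1 + e * b^-1 <= (a / b) `^ (- e).
  rewrite /powR gt_eqF ?divr_gt0 //; apply: le_trans (expR_ge1Dx _).
  by rewrite lerD2l mulNr -mulrN ler_pM2l // lerNr.
move=> h; rewrite -[X in _ - X]mulr1 -mulrBr [leRHS]mulrCA [leLHS]mulrC ler_wpM2l ?powR_ge0 //.
by rewrite ler_pdivlMl // lerBrDl.
Qed.

Lemma sum_riemannR_le (R : realType) (e : R) n : 0 < e ->
  \sum_(k < n) riemannR (1 + e) k <= 1 + e^-1.
Proof.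
move=> e0; case: n => [|n]; first by rewrite big_ord0 addr_ge0 ?invr_ge0 ?ltW.
rewrite big_ord_recl; apply: lerD; first by rewrite /riemannR powR1 invr1.
apply: (@le_trans _ _ (e^-1 * (1 - n.+1%:R `^ (- e)))); last first.
  by rewrite -[leRHS]mulr1 ler_pM2l ?invr_gt0 // gerBl powR_ge0.
elim: n => [|n IH]; first by rewrite big_ord0 powR1 subrr mulr0.
rewrite big_ord_recr /=; apply: le_trans (lerD IH (riemannR_telescope n e0)) _.
by rewrite -mulrDr addrA subrK.
Qed.

Lemma bounded_sums_eventually (R : realType) (u v : nat -> R) (K0 : nat) (M : R) :
  (forall K, 0 <= v K) -> (forall K, (K0 <= K)%N -> u K <= v K) ->
  (forall n, \sum_(K < n) v K <= M) ->
  exists M', forall n, \sum_(K < n) u K <= M'.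
Proof.
move=> v0 uv vM; exists (\sum_(K < K0) `|u K| + M) => n.
apply: (@le_trans _ _ (\sum_(K < minn n K0) `|u K| + \sum_(K < n) v K)).
  elim: n => [|n IH]; first by rewrite min0n !big_ord0 addr0.
  rewrite !big_ord_recr /= addrA; have [nK|Kn] := ltnP n K0.
    move: IH; rewrite (minn_idPl nK) (minn_idPl (ltnW nK)) big_ord_recr /= => IH.
    have := ler_norm (u n); have := v0 n; lra.
  rewrite (minn_idPr (leqW Kn)); move: IH; rewrite (minn_idPr Kn).
  by have := uv n Kn; lra.
rewrite lerD //.
by rewrite -[in leRHS](subnKC (geq_minr n K0)) big_split_ord lerDl sumr_ge0.
Qed.

(** The number whose [q]-th power is 2. For [q = s.+1 / r.+1] it is the growth factor per level of
    the translation vectors found in [odometer_shift]. *)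
Definition dilation (R : realType) (q : R) : R := 2 `^ q^-1.

Lemma dilation_gt1 (R : realType) (q : R) : 0 < q -> 1 < dilation q.
Proof.
move=> q0; rewrite /dilation /powR gt_eqF //.
by rewrite expR_gt1 mulr_gt0 ?invr_gt0 // ln_gt0 // ltr1n.
Qed.

Lemma powR_dilation (R : realType) (q p : R) K : 0 < q ->
  (dilation q ^+ K) `^ p = (2 `^ (p / q)) ^+ K.
Proof.
move=> q0; have d0 : 0 <= dilation q by exact: powR_ge0.
rewrite -!powR_mulrn ?powR_ge0 //.
by rewrite powRAC /dilation -(powRrM 2) [q^-1 * p]mulrC.
Qed.

(** With [d = dilation q], the power of [d ^+ K] is [2 ^+ K] and cancels [2 ^- K], while its
    logarithm is [K * ln d]; what remains is a multiple of [K ^ -(1 + e)]. *)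
Lemma power_over_log_summable (R : realType) (q e : R) (phi : R -> R) :
  0 < q -> 0 < e ->
  (\forall x \near +oo, phi x = power_over_log q e x) ->
  exists M, forall n, \sum_(K < n) phi (dilation q ^+ K) * 2 ^- K <= M.
Proof.
move=> q0 e0 [A [_ phiA]].
have d1 := dilation_gt1 q0; have l0 := ln_gt0 d1.
pose c := (ln (dilation q) `^ (1 + e))^-1.
have c0 : 0 <= c by rewrite invr_ge0 powR_ge0.
have [K0 [K0pos dK]] : exists K0, (0 < K0)%N /\
    forall K, (K0 <= K)%N -> A < dilation q ^+ K.
  (* Bernoulli's inequality: [K * (d - 1) < d ^+ K]. *)
  have d0 : 0 < dilation q - 1 by rewrite subr_gt0.
  exists (Num.truncn (A / (dilation q - 1))).+1; split=> // K hK.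
  have : A / (dilation q - 1) < K%:R.
    by apply: lt_le_trans (truncnS_gt _) _; rewrite ler_nat.
  rewrite ltr_pdivrMr // => h; apply: lt_trans h _.
  elim: K {hK} => [|K IH]; first by rewrite mul0r expr0.
  rewrite -natr1 mulrDl mul1r exprS.
  have : 1 <= dilation q ^+ K by rewrite exprn_ege1 // ltW.
  by move: IH d0 => IH d0 h; nra.
(* [riemannR] is shifted by one, and index 0, where the logarithm vanishes, is excluded by
   [0 < K0]. *)
pose v K := c * (if K is L.+1 then riemannR (1 + e) L else 0).
apply: (@bounded_sums_eventually _
  (fun K => phi (dilation q ^+ K) * 2 ^- K) v K0 (c * (1 + e^-1))).
- case=> [|K]; first by rewrite /v mulr0.
  by rewrite mulr_ge0 // ltW // riemannR_gt0 // addr_ge0 // ltW.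
- move=> K hK; rewrite phiA ?dK // /power_over_log.
  rewrite powR_dilation // divff ?gt_eqF // powRr1 //.
  rewrite lnXn ?(lt_trans _ d1) // -[_ *+ K]mulr_natl powRM ?ler0n ?(ltW l0) //.
  case: K hK => [|K hK]; first by rewrite leqNgt K0pos.
  rewrite invfM [2 ^+ _ * _]mulrC mulfK ?expf_neq0 // mulrC.
  by rewrite /v /riemannR /c.
- case=> [|n]; first by rewrite big_ord0 mulr_ge0 // addr_ge0 // invr_ge0 ltW.
  rewrite big_ord_recl {1}/v mulr0 add0r -mulr_sumr ler_wpM2l //.
  exact: sum_riemannR_le.
Qed.

Lemma powR_summable (R : realType) (q p : R) : 0 <= p < q ->
  exists M, forall n, \sum_(K < n) (dilation q ^+ K) `^ p * 2 ^- K <= M.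
Proof.
move=> /andP[p0 pq]; have q0 : 0 < q by exact: le_lt_trans pq.
exists (1 - 2 `^ (p / q) / 2)^-1 => n.
under eq_bigr do rewrite powR_dilation // -exprVn -exprMn.
apply: sum_expr_le; rewrite divr_ge0 ?powR_ge0 //=.
rewrite ltr_pdivrMr // mul1r -[ltRHS]powRr1 //.
rewrite /powR gt_eqF // ltr_expR ltr_pM2r ?ln_gt0 ?ltr1n //.
by rewrite ltr_pdivrMr // mul1r.
Qed.

(** * Integrability *)

Lemma dilation_ge (R : realType) r s K :
  (2 ^ ((r.+1 * K) %/ s.+1))%N%:R <= dilation (s.+1%:R / r.+1%:R) ^+ K :> R.
Proof.
rewrite natrX -!powR_mulrn ?powR_ge0 // /dilation -powRrM.
apply: ler_powR; first by rewrite ler1n.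
rewrite invf_div mulrAC ler_pdivlMr ?ltr0n // -!natrM ler_nat.
exact: leq_trunc_div.
Qed.

Lemma odometer_integral_finite (R : realType) r s (S : set 'rV[int]_s.+1)
    (phi : R -> R) (g : 'rV[int]_r.+1) :
  symmetric_generating S -> integrability_rate phi ->
  (exists M, forall n, \sum_(K < n)
     phi (dilation (s.+1%:R / r.+1%:R) ^+ K) * 2 ^- K <= M) ->
  exists2 c : R, 0 < c &
    (\int[@fair_measure R]_x
      (phi ((orbit_dist S (@odometer s) x (odometer g x))%:R / c))%:E < +oo)%E.
Proof.
move=> genS [phi0 phi_le] [M phiM].
have [C SC] := word_length_box genS.
(* The factor 2 absorbs the rounding up in [odometer_shift], and [C.+1] keeps the constant
   positive. *)
have c0 : 0 < (C.+1 * 2)%:R :> R by rewrite ltr0n muln_gt0.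
exists (C.+1 * 2)%:R => //.
pose B K : set (bit_space R) := if K is L.+1 then carries L g else setT.
have d0 K : 0 <= dilation (s.+1%:R / r.+1%:R) ^+ K :> R.
  by rewrite exprn_ge0 // powR_ge0.
(* In the constant, 1 is for the whole space as layer 0, and the factor 2 for the index shift
   between [B] and [carries]. *)
apply: (@integral_layers_finite R _ _ _ B
  (fun K => phi (dilation (s.+1%:R / r.+1%:R) ^+ K)) (1 + 2 * (l1_norm g)%:R) M) => //.
- by case=> [|K]; [exact: measurableT|exact: measurable_carries].
- case=> [|K] /=.
    by rewrite fair_measure_setT lee_fin expr0 invr1 mulr1 lerDl mulr_ge0.
  apply: le_trans (fair_measure_carries R K g) _; rewrite lee_fin exprS invfM mulrA.
  by rewrite ler_wpM2r ?invr_ge0 ?exprn_ge0 //; lra.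
- by move=> x; apply: phi0; rewrite divr_ge0.
- by move=> K; exact: phi0.
- move=> K x nc; have [h hx hK] := odometer_shift s nc.
  apply: phi_le; first by rewrite divr_ge0.
  apply: le_trans (dilation_ge R r s K); rewrite ler_pdivrMr // -natrM ler_nat.
  apply: leq_trans (orbit_dist_le S hx) _; apply: leq_trans (SC _ _ hK) _.
  by rewrite expnS; nia.
Qed.

Lemma integrability_rate_powR (R : realType) (p : R) : 0 <= p ->
  integrability_rate (fun t : R => t `^ p).
Proof.
move=> p0; split=> [x _|x y x0 xy]; first exact: powR_ge0.
by apply: ge0_ler_powR => //; rewrite nnegrE // (le_trans x0).
Qed.

Theorem theorem6p12 (R : realType) (n m : nat) (n_gt0 : (0 < n)%N)
    (m_gt0 : (0 < m)%N) :
  (exists C : oe_coupling R 'rV[int]_m 'rV[int]_n,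
    forall (SG : set 'rV[int]_m) (SH : set 'rV[int]_n),
    symmetric_generating SG -> symmetric_generating SH ->
    forall (eps : R), 0 < eps ->
    forall phi psi : R -> R,
    integrability_rate phi -> integrability_rate psi ->
    (\forall x \near +oo, phi x = power_over_log (n%:R / m%:R) eps x) ->
    (\forall x \near +oo, psi x = power_over_log (m%:R / n%:R) eps x) ->
    oe_integrable SG SH phi psi C) /\
  ((n < m)%N ->
   exists C : oe_coupling R 'rV[int]_m 'rV[int]_n,
     forall (SG : set 'rV[int]_m) (SH : set 'rV[int]_n),
     symmetric_generating SG -> symmetric_generating SH ->
     forall p p' : R, 0 <= p < n%:R / m%:R -> 0 <= p' < m%:R / n%:R ->
     oe_integrable SG SH (fun t => t `^ p) (fun t => t `^ p') C).
Proof.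
(* One coupling, with [m = r.+1] and [n = s.+1], witnesses both claims; the two integrability
   conditions are exchanged by swapping [r] and [s]. *)
case: n m n_gt0 m_gt0 => [//|s] [//|r] _ _.
split=> [|_]; exists (odometer_coupling R r s) => SG SH genG genH.
- move=> eps eps0 phi psi rphi rpsi phiE psiE.
  have q0 a b : 0 < a.+1%:R / b.+1%:R :> R by rewrite divr_gt0 ?ltr0n.
  split=> [g|h].
  + exact: (@odometer_integral_finite R r s SH phi g genH rphi
      (power_over_log_summable (q0 s r) eps0 phiE)).
  + exact: (@odometer_integral_finite R s r SG psi h genG rpsi
      (power_over_log_summable (q0 r s) eps0 psiE)).
- move=> p p' hp hp'; have /andP[p0 _] := hp; have /andP[p'0 _] := hp'.
  split=> [g|h].
  + exact: (@odometer_integral_finite R r s SH _ g genH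
      (integrability_rate_powR p0) (powR_summable hp)).
  + exact: (@odometer_integral_finite R s r SG _ h genG
      (integrability_rate_powR p'0) (powR_summable hp')).
Qed.
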